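(* Let $(X,\|\cdot\|)$ be a normed space of dimension at least $2$ with unit ball $\mathbf{B}$, and let $\rho>0$. Let $H$ be a supporting hyperplane to $\mathbf{B}$ at a point $x$ (so $\|x\|=1$ and $x\in H$). Let $H^-$ and $H^+$ denote the closed half-spaces with boundary $H$ that contain $\mathbf{B}$ and do not contain $\mathbf{B}$, respectively. Then \[ \inf_{y\in H^+:\ \|x-y\|\ge\rho}\|y\|=\inf_{y\in H:\ \|x-y\|=\rho}\|y\| \quad\text{and}\quad \sup_{z\in H^-:\ \|x-z\|\le\rho}\|z\|=\sup_{z\in H:\ \|x-z\|=\rho}\|z\|. \]
   Context: Normed spaces are real. $\mathbf{B}=\{x\in X:\|x\|\le1\}$. A supporting hyperplane to $\mathbf{B}$ at $x$ is a set $H=\{y: f(y)=\|f\|\}$ where $f$ is a non-zero continuous linear functional with $f(x)=\|f\|$ and $\|x\|=1$; then $H^-=\{y:f(y)\le\|f\|\}$ and $H^+=\{y:f(y)\ge\|f\|\}$. *)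

(* Defs.v *)
From HB Require Import structures.
From mathcomp Require Import all_boot all_order all_algebra.
From mathcomp Require Import all_classical all_reals all_analysis.

Set Implicit Arguments.
Unset Strict Implicit.
Unset Printing Implicit Defensive.

Import Order.TTheory GRing.Theory Num.Theory.
Import numFieldNormedType.Exports.

Local Open Scope classical_set_scope.
Local Open Scope ring_scope.

Section SupportingHyperplane.
Context {R : realType} {X : normedModType R}.

(* [X] may be infinite-dimensional, so the dimension bound is expressed by two
   linearly independent vectors. *)
Definition dim_ge2 (V : lmodType R) : Prop :=
  exists u v : V, forall a b : R, a *: u + b *: v = 0 -> a = 0 /\ b = 0.

Definition unit_ball : set X := [set y | `|y| <= 1].

(* For continuous [f] the set is nonempty and bounded, so the real-valued [sup]
   is a genuine least upper bound. *)
Definition dual_norm (f : X -> R) : R := sup [set `|f y| | y in unit_ball].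

Definition hyperplane (f : X -> R) : set X := [set y | f y = dual_norm f].
Definition lower_halfspace (f : X -> R) : set X := [set y | f y <= dual_norm f].
Definition upper_halfspace (f : X -> R) : set X := [set y | dual_norm f <= f y].

(* [hyperplane f] is a supporting hyperplane to [unit_ball] at [x]. *)
Definition supports_at (f : {linear X -> R^o}) (x : X) : Prop :=
  [/\ continuous f, exists y, f y != 0, `|x| = 1 & hyperplane f x].

End SupportingHyperplane.

(* Main.v *)
Require Import Defs.
From HB Require Import structures.
From mathcomp Require Import all_boot all_order all_algebra.
From mathcomp Require Import all_classical all_reals all_analysis.
From mathcomp Require Import lra.

Set Implicit Arguments.
Unset Strict Implicit.
Unset Printing Implicit Defensive.

Import Order.TTheory GRing.Theory Num.Theory.
Import numFieldNormedType.Exports.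

Local Open Scope classical_set_scope.
Local Open Scope ring_scope.

(** Directions are taken from the centre [x].  The supporting functional splits
    every point as [x + (tau x + kap w)] with [f w = 0], [`|w| = rho] and
    [0 <= kap], so that [x + w] is the point of the hyperplane which lies on the
    sphere of radius [rho] around [x] and on the same side as the given point.
    The tool is the monotonicity lemma of Minkowski planes
    ([norm_shift_mono]): turning away from the direction [- x] of the origin,
    and possibly moving farther from [x], does not decrease the norm, provided
    the final norm is at least [`|x|].  A point of the upper half-space outside
    the sphere is reached in this way from [x + w], hence has norm at least
    [`|x + w|]; a point of the lower half-space inside the sphere reaches
    [x + w] in this way, hence has norm at most [`|x + w|].  The proviso holds
    because the functional is at least its dual norm at both final points.
    So each point of the larger set is dominated by a point of the smaller one
    ([upper_point_dominates] and [lower_point_dominated]), and the reverse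
    inequalities are inclusions of sets.  The dimension hypothesis supplies [w]
    when the given point lies on the line through [0] and [x]. *)

(** Monotonicity lemma: [u] lies angularly between [v] and [- x].  If [u] is
    beyond the segment from [- x] to [v], that segment crosses the one from [0]
    to [u], and two triangle inequalities through the crossing point give
    [`|u + x| + `|v| <= `|u| + `|v + x|].  Otherwise [u] is in the triangle with
    vertices [0], [- x], [v], on which the convex function [`|_ + x|] is at most
    its largest vertex value [`|v + x|]. *)
Lemma norm_shift_mono (R : realType) (X : normedModType R) (x u v : X)
    (al be : R) :
  0 <= al -> 0 <= be -> u = al *: v - be *: x ->
  `|u| <= `|v| -> `|x| <= `|v + x| -> `|u + x| <= `|v + x|.
Proof.
move=> al0 be0 uE uv xv.
have vE : al *: v = u + be *: x by rewrite uE subrK.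
have [s1|s1] := leP 1 (al + be).
- have s0 : 0 < al + be by lra.
  (* The crossing point is [(al + be)^-1 *: u]; denominators are cleared. *)
  have e1 : (al + be) *: (u + x) = (al + be - 1) *: u + al *: (v + x).
    rewrite [al *: (v + x)]scalerDr vE -(addrA u) -scalerDl scalerBl scale1r addrA.
    by rewrite subrK scalerDr [be + al]addrC.
  have e2 : (al + be) *: v = u + be *: (v + x).
    by rewrite uE scalerDr scalerDl [be *: v + _]addrC addrA subrK.
  have n1 : (al + be) * `|u + x| <= (al + be - 1) * `|u| + al * `|v + x|.
    rewrite -[X in X * `|u + x|]gtr0_norm// -normrZ e1.
    rewrite (le_trans (ler_normD _ _))// !normrZ ger0_norm ?subr_ge0//.
    by rewrite (ger0_norm al0).
  have n2 : (al + be) * `|v| <= `|u| + be * `|v + x|.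
    rewrite -[X in X * `|v|]gtr0_norm// -normrZ e2.
    by rewrite (le_trans (ler_normD _ _))// !normrZ (ger0_norm be0).
  rewrite -(ler_pM2l s0); have := ler_wpM2l (ltW s0) uv; lra.
- have -> : u + x = al *: (v + x) + (1 - (al + be)) *: x.
    rewrite scalerDr vE -!addrA -!scalerDl.
    by rewrite [X in X *: x](_ : _ = 1) ?scale1r//; lra.
  rewrite (le_trans (ler_normD _ _))// !normrZ (ger0_norm al0) ger0_norm; last lra.
  have s2 : 0 <= 1 - (al + be) by lra.
  have := ler_wpM2l s2 xv; have := mulr_ge0 be0 (normr_ge0 (v + x)); lra.
Qed.

Lemma dual_normP (R : realType) (X : normedModType R) (f : {linear X -> R^o})
    (y : X) : continuous f -> `|f y| <= dual_norm f * `|y|.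
Proof.
move=> cf; have [->|y0] := eqVneq y 0; first by rewrite linear0 !normr0 mulr0.
have ny : 0 < `|y| by rewrite normr_gt0.
have [k [_ kf]] := (linear_boundedP f).1 (continuous_linear_bounded 0 (cf 0)).
rewrite -ler_pdivrMr//; apply: ub_le_sup.
  exists (`|k| + 1) => _ [z /= z1 <-].
  have kk : k < `|k| + 1 by rewrite (le_lt_trans (ler_norm k))// ltrDl.
  rewrite (le_trans (kf _ kk z))// -[leRHS]mulr1 ler_wpM2l// addr_ge0//.
exists (`|y|^-1 *: y); rewrite /unit_ball/=.
  by rewrite normrZ normfV normr_id mulVf// gt_eqF.
by rewrite linearZ/= normrZ normfV normr_id mulrC.
Qed.

Lemma supports_at_gt0 (R : realType) (X : normedModType R)
    (f : {linear X -> R^o}) (x : X) : supports_at f x -> 0 < dual_norm f.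
Proof.
case=> cf [y fy] x1 _; rewrite lt_neqAle; apply/andP; split; last first.
  by have := dual_normP x cf; rewrite x1 mulr1; apply: le_trans.
apply: contra fy => /eqP N0.
by have := dual_normP y cf; rewrite -N0 mul0r normr_le0.
Qed.

Lemma upper_halfspace_norm (R : realType) (X : normedModType R)
    (f : {linear X -> R^o}) (x y : X) :
  supports_at f x -> upper_halfspace f y -> 1 <= `|y|.
Proof.
move=> hf fy; have N0 := supports_at_gt0 hf; case: hf => cf _ _ _.
rewrite -(ler_pM2l N0) mulr1 (le_trans fy)// (le_trans (ler_norm _))//.
exact: dual_normP.
Qed.

Lemma dim_ge2_ker (R : realType) (X : normedModType R) (f : {linear X -> R^o}) :
  dim_ge2 X -> exists2 w : X, w != 0 & f w = 0.
Proof.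
move=> [u [v uv]]; have [fu|fu] := eqVneq (f u) 0.
  exists u => //; apply/eqP => u0.
  have [] := uv 1 0; first by rewrite u0 scaler0 scale0r addr0.
  by move=> /eqP; rewrite oner_eq0.
exists (f v *: u - f u *: v).
  apply/eqP => w0; have [] := uv (f v) (- f u); first by rewrite scaleNr.
  by move=> _ /eqP; rewrite oppr_eq0 (negPf fu).
by rewrite linearB !linearZ/= /GRing.scale/= mulrC mulrN subrr.
Qed.

(** The component of [y - x] in the kernel of [f] is rescaled to length [rho];
    when it vanishes, any kernel vector of that length serves, with [kap = 0]. *)
Lemma hyperplane_decomposition (R : realType) (X : normedModType R)
    (hX : dim_ge2 X) (rho : R) (f : {linear X -> R^o}) (x y : X) :
  0 < rho -> f x != 0 ->
  exists w kap, [/\ f w = 0, `|w| = rho, 0 <= kap &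
                   y - x = (f (y - x) / f x) *: x + kap *: w].
Proof.
move=> rho0 fx0.
have scaled (w : X) : f w = 0 -> w != 0 ->
    f ((rho / `|w|) *: w) = 0 /\ `|(rho / `|w|) *: w| = rho.
  move=> fw w0; rewrite linearZ/= fw scaler0; split=> //.
  by rewrite normrZ normrM normfV normr_id (gtr0_norm rho0) divfK ?normr_eq0.
set tau := f (y - x) / f x; pose w := y - x - tau *: x.
have yE : y - x = tau *: x + w by rewrite [RHS]addrC subrK.
have fw : f w = 0.
  by rewrite /w linearB linearZ/= /tau /GRing.scale/= divfK ?subrr.
have [w0|w0] := eqVneq w 0.
  have [w' w'0 fw'] := dim_ge2_ker f hX.
  have [fW nW] := scaled _ fw' w'0.
  exists ((rho / `|w'|) *: w'), 0; split=> //.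
  by rewrite scale0r yE w0.
have [fW nW] := scaled _ fw w0.
exists ((rho / `|w|) *: w), (`|w| / rho); split=> //.
  by rewrite divr_ge0// ltW.
rewrite scalerA mulrA divfK ?gt_eqF// divff ?normr_eq0// scale1r.
exact: yE.
Qed.

Lemma hyperplane_translate (R : realType) (X : normedModType R)
    (f : {linear X -> R^o}) (x w : X) :
  hyperplane f x -> f w = 0 -> hyperplane f (w + x).
Proof. by move=> fx fw; rewrite /hyperplane/= linearD fw add0r. Qed.

(** In [y - x = tau x + kap w] one has [0 <= tau].  For [0 < kap] this puts [w]
    angularly between [y - x] and [- x]; for [kap = 0] the direction of [y - x]
    is opposite to [- x], and [w] is no combination of the two. *)
Lemma upper_point_dominates (R : realType) (X : normedModType R)
    (hX : dim_ge2 X) (rho : R) (hrho : 0 < rho) (f : {linear X -> R^o})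
    (x y : X) :
  supports_at f x -> upper_halfspace f y -> rho <= `|x - y| ->
  exists y', [/\ hyperplane f y', `|x - y'| = rho & `|y'| <= `|y|].
Proof.
move=> hf fy dy; have N0 := supports_at_gt0 hf.
have y1 := upper_halfspace_norm hf fy; case: hf => cf _ x1 fx.
have fx0 : f x != 0 by rewrite fx gt_eqF.
have [w [kap [fw nw kap0 yE]]] := hyperplane_decomposition hX y hrho fx0.
set tau := _ / _ in yE.
have tau0 : 0 <= tau.
  by rewrite /tau linearB/= divr_ge0// fx ?subr_ge0// ltW.
exists (w + x); split; first exact: hyperplane_translate.
  by rewrite opprD addrCA subrr addr0 normrN.
have [k0|k0] := eqVneq kap 0.
  (* [y = (1 + tau) x] with [rho <= tau]: the triangle inequality suffices. *)
  have dE : y - x = tau *: x by rewrite yE k0 scale0r addr0.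
  have -> : y = (1 + tau) *: x by rewrite scalerDl scale1r -dE addrC subrK.
  rewrite (le_trans (ler_normD _ _))// nw x1 normrZ x1 mulr1.
  move: dy; rewrite distrC dE normrZ x1 mulr1 !ger0_norm//; last by rewrite addr_ge0.
  by rewrite addrC lerD2l.
rewrite -[y in leRHS](subrK x).
apply: (@norm_shift_mono _ _ x w (y - x) kap^-1 (kap^-1 * tau)).
- by rewrite invr_ge0.
- by rewrite mulr_ge0// invr_ge0.
- by rewrite yE scalerDr !scalerA mulVf// scale1r addrAC subrr add0r.
- by rewrite nw distrC.
- by rewrite subrK x1.
Qed.

(** Here [z - x] is angularly between [w] and [- x], because
    [z - x = tau x + kap w] with [tau <= 0]. *)
Lemma lower_point_dominated (R : realType) (X : normedModType R)
    (hX : dim_ge2 X) (rho : R) (hrho : 0 < rho) (f : {linear X -> R^o})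
    (x z : X) :
  supports_at f x -> lower_halfspace f z -> `|x - z| <= rho ->
  exists z', [/\ hyperplane f z', `|x - z'| = rho & `|z| <= `|z'|].
Proof.
move=> hf fz dz; have N0 := supports_at_gt0 hf; have [cf _ x1 fx] := hf.
have fx0 : f x != 0 by rewrite fx gt_eqF.
have [w [kap [fw nw kap0 zE]]] := hyperplane_decomposition hX z hrho fx0.
set tau := _ / _ in zE.
have tau0 : tau <= 0.
  by rewrite /tau linearB/= mulr_le0_ge0 ?invr_ge0 ?fx ?subr_le0// ltW.
have Hw := hyperplane_translate fx fw.
exists (w + x); split => //.
  by rewrite opprD addrCA subrr addr0 normrN.
rewrite -[z in leLHS](subrK x).
apply: (@norm_shift_mono _ _ x (z - x) w kap (- tau)) => //.
- by rewrite oppr_ge0.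
- by rewrite zE scaleNr opprK addrC.
- by rewrite nw distrC.
- by rewrite x1 (upper_halfspace_norm hf)// /upper_halfspace/= Hw.
Qed.

(* Extrema are taken in the extended reals, so no convention for empty or
   unbounded sets of reals is involved. *)
Theorem lemma1p5 (R : realType) (X : normedModType R) (hX : dim_ge2 X)
    (rho : R) (hrho : 0 < rho) (f : {linear X -> R^o}) (x : X)
    (hf : supports_at f x) :
  ereal_inf [set (`|y|)%:E | y in [set y | upper_halfspace f y /\ rho <= `|x - y|]]
    = ereal_inf [set (`|y|)%:E | y in [set y | hyperplane f y /\ `|x - y| = rho]]
  /\
  ereal_sup [set (`|z|)%:E | z in [set z | lower_halfspace f z /\ `|x - z| <= rho]]
    = ereal_sup [set (`|z|)%:E | z in [set z | hyperplane f z /\ `|x - z| = rho]].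
Proof.
split; apply/eqP; rewrite eq_le; apply/andP; split.
- apply: ereal_inf_le_tmp => _ [y [fy dy] <-]; exists y => //; split.
    by rewrite /upper_halfspace/= fy.
  by rewrite dy.
- apply: le_ereal_inf_tmp => _ [y [fy dy] <-].
  have [y' [fy' dy' yy']] := upper_point_dominates hX hrho hf fy dy.
  apply: (@le_trans _ _ (`|y'|)%:E); last by rewrite lee_fin.
  by apply: ereal_inf_lbound; exists y'.
- apply: ge_ereal_sup => _ [z [fz dz] <-].
  have [z' [fz' dz' zz']] := lower_point_dominated hX hrho hf fz dz.
  apply: (@le_trans _ _ (`|z'|)%:E); first by rewrite lee_fin.
  by apply: ereal_sup_ubound; exists z'.
- apply: ereal_sup_le => _ [z [fz dz] <-]; exists z => //; split.
    by rewrite /lower_halfspace/= fz.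
  by rewrite dz.
Qed.
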